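(* Let $\Sigma$ be a signature. There exists a natural transformation $\gamma_{\Sigma}$ from $L_{\Sigma}$ to $K_{\Sigma}$.
   Context: A signature $\Sigma=(\Sigma_n)_{n\in\mathbb{N}}$ assigns to each $n\in\mathbb{N}$ a set $\Sigma_n$ of operation symbols of arity $n$. A $\Sigma$-algebra $\mathbf{A}=(A,F)$ is a set $A$ with an operation $F_\sigma\colon A^n\to A$ for each $n$ and each $\sigma\in\Sigma_n$; the empty algebra is allowed when $\Sigma_0=\varnothing$. Homomorphisms are the maps preserving all operations; $\mathsf{Alg}(\Sigma)$ is the resulting category. A sup-semilattice is an ordered set $\mathbf{I}=(I,\leq)$ in which any two elements $i,j$ have a least upper bound $i\vee j$; morphisms are the maps preserving $\vee$; $\mathsf{Ssl}$ is the resulting category. For a sup-semilattice $\mathbf{I}$, an $\mathbf{I}$-inductive system of $\Sigma$-algebras is a pair $\mathcal{A}=((\mathbf{A}_i)_{i\in I},(f_{i,j})_{i\leq j})$ with $\mathbf{A}_i$ a $\Sigma$-algebra, $f_{i,j}\colon\mathbf{A}_i\to\mathbf{A}_j$ a homomorphism for $i\leq j$, $f_{i,i}=\mathrm{id}$, and $f_{j,k}\circ f_{i,j}=f_{i,k}$ for $i\leq j\leq k$. A morphism $u\colon\mathcal{A}\to((\mathbf{B}_i)_{i\in I},(g_{i,j})_{i\leq j})$ of $\mathbf{I}$-inductive systems is a family of homomorphisms $u_i\colon\mathbf{A}_i\to\mathbf{B}_i$ with $u_j\circ f_{i,j}=g_{i,j}\circ u_i$ for $i\leq j$. For $\xi\colon\mathbf{I}\to\mathbf{P}$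 in $\mathsf{Ssl}$ and a $\mathbf{P}$-inductive system $\mathcal{B}=((\mathbf{B}_p)_{p\in P},(g_{p,q})_{p\leq q})$, put $\mathcal{B}_\xi=((\mathbf{B}_{\xi(i)})_{i\in I},(g_{\xi(i),\xi(j)})_{i\leq j})$. The category $\int^{\mathsf{Ssl}}\mathrm{Isys}_{\Sigma}$ (a Grothendieck construction) has as objects the pairs $(\mathbf{I},\mathcal{A})$ with $\mathbf{I}$ a sup-semilattice and $\mathcal{A}$ an $\mathbf{I}$-inductive system of $\Sigma$-algebras. A morphism $(\mathbf{I},\mathcal{A})\to(\mathbf{P},\mathcal{B})$ is a pair $(\xi,u)$ with $\xi\colon\mathbf{I}\to\mathbf{P}$ in $\mathsf{Ssl}$ and $u\colon\mathcal{A}\to\mathcal{B}_\xi$ a morphism of $\mathbf{I}$-inductive systems; composition is $(\psi,v)\circ(\xi,u)=(\psi\circ\xi,(v_{\xi(i)}\circ u_i)_{i\in I})$. Functor $L_\Sigma\colon\mathsf{Ssl}\to\int^{\mathsf{Ssl}}\mathrm{Isys}_{\Sigma}$: let $\mathbf{T}_\Sigma(\varnothing)$ be the free $\Sigma$-algebra on the empty set (the initial $\Sigma$-algebra). Then $L_\Sigma(\mathbf{I})$ is $\mathbf{I}$ together with the constant system with all algebras $\mathbf{T}_\Sigma(\varnothing)$ and all transition homomorphisms identities, and $L_\Sigma(\xi)=(\xi,(\mathrm{id}_{\mathbf{T}_\Sigma(\varnothing)})_{i\in I})$. Functor $K_\Sigma\colon\mathsf{Ssl}\to\int^{\mathsf{Ssl}}\mathrm{Isys}_{\Sigma}$: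 for an element $i$ let $\mathbf{K}_{\{i\}}$ be the unique $\Sigma$-algebra with underlying set $\{i\}$. Then $K_\Sigma(\mathbf{I})$ is $\mathbf{I}$ together with the algebras $(\mathbf{K}_{\{i\}})_{i\in I}$ and the unique homomorphisms between them, and $K_\Sigma(\xi)$ is $\xi$ together with the unique homomorphisms $\mathbf{K}_{\{i\}}\to\mathbf{K}_{\{\xi(i)\}}$, $i\in I$. *)

(* Defs.v *)
From Stdlib Require Import Relations.
From Stdlib Require Fin.
From Stdlib Require Import FunctionalExtensionality ProofIrrelevance.

Set Implicit Arguments.
Unset Strict Implicit.
Unset Printing Implicit Defensive.

Record category : Type := Category {
  obj :> Type;
  hom : obj -> obj -> Type;
  idm : forall x, hom x x;
  comp : forall x y z, hom y z -> hom x y -> hom x z;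
  comp_id_l : forall x y (f : hom x y), comp (idm y) f = f;
  comp_id_r : forall x y (f : hom x y), comp f (idm x) = f;
  comp_assoc : forall w x y z (h : hom y z) (g : hom x y) (f : hom w x),
    comp h (comp g f) = comp (comp h g) f
}.

Arguments hom {c} x y.
Arguments idm {c} x.
Arguments comp {c x y z} g f.

Declare Scope category_scope.
Delimit Scope category_scope with cat.
Notation "g ∘ f" := (comp g f)
  (at level 40, left associativity) : category_scope.
Local Open Scope category_scope.

Record functor (C D : category) : Type := Functor {
  fobj :> C -> D;
  fmap : forall x y : C, hom x y -> hom (fobj x) (fobj y);
  fmap_id : forall x : C, fmap (idm x) = idm (fobj x);
  fmap_comp : forall (x y z : C) (g : hom y z) (f : hom x y),
    fmap (g ∘ f) = fmap g ∘ fmap f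
}.

Arguments fmap {C D} _ {x y} _.

Record natural_transformation (C D : category) (F G : functor C D) : Type :=
  NaturalTransformation {
    component :> forall x : C, hom (F x) (G x);
    naturality : forall (x y : C) (f : hom x y),
      fmap G f ∘ component x = component y ∘ fmap F f
  }.

Definition signature : Type := nat -> Type.

Record algebra (Sigma : signature) : Type := Algebra {
  carrier :> Type;
  op : forall n, Sigma n -> (Fin.t n -> carrier) -> carrier
}.

Arguments op {Sigma} a {n} _ _.

Record algebra_hom (Sigma : signature) (A B : algebra Sigma) : Type :=
  AlgebraHom {
    algebra_fun :> A -> B;
    algebra_fun_op : forall n (s : Sigma n) (a : Fin.t n -> A),
      algebra_fun (op A s a) = op B s (fun k => algebra_fun (a k))
  }.

Lemma algebra_hom_ext (Sigma : signature) (A B : algebra Sigma)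
  (f g : algebra_hom A B) : (forall a, f a = g a) -> f = g.
Proof.
destruct f as [f Hf], g as [g Hg]; simpl; intros e.
assert (f = g) by (apply functional_extensionality; exact e).
subst g; f_equal; apply proof_irrelevance.
Qed.

Definition algebra_id (Sigma : signature) (A : algebra Sigma) :
  algebra_hom A A.
Proof. exists (fun a => a); reflexivity. Defined.

Definition algebra_comp (Sigma : signature) (A B C : algebra Sigma)
  (g : algebra_hom B C) (f : algebra_hom A B) : algebra_hom A C.
Proof.
exists (fun a => g (f a)).
intros n s a; rewrite (algebra_fun_op f); apply algebra_fun_op.
Defined.

Definition Alg (Sigma : signature) : category.
Proof.
refine (@Category (algebra Sigma) (@algebra_hom Sigma)
          (@algebra_id Sigma) (@algebra_comp Sigma) _ _ _);
  intros; apply algebra_hom_ext; reflexivity.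
Defined.

Inductive term (Sigma : signature) (X : Type) : Type :=
| Var : X -> term Sigma X
| App : forall n, Sigma n -> (Fin.t n -> term Sigma X) -> term Sigma X.

Arguments App {Sigma X n} _ _.

Definition free_algebra (Sigma : signature) (X : Type) : algebra Sigma :=
  @Algebra Sigma (term Sigma X) (fun n s a => App s a).

Definition singleton_algebra (Sigma : signature) (X : Type) (x : X) :
  algebra Sigma :=
  @Algebra Sigma {y : X | y = x} (fun _ _ _ => exist (fun y => y = x) x eq_refl).

Lemma singleton_unique (X : Type) (x : X) (a b : {y : X | y = x}) : a = b.
Proof. destruct a as [a ->], b as [b ->]; reflexivity. Qed.

Definition to_singleton (Sigma : signature) (A : algebra Sigma)
  (X : Type) (x : X) : algebra_hom A (singleton_algebra Sigma x).
Proof. exists (fun _ => exist (fun y => y = x) x eq_refl); reflexivity. Defined.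

Lemma to_singleton_unique (Sigma : signature) (A : algebra Sigma)
  (X : Type) (x : X) (f g : algebra_hom A (singleton_algebra Sigma x)) :
  f = g.
Proof. apply algebra_hom_ext; intros a; apply singleton_unique. Qed.

Record sup_semilattice : Type := SupSemilattice {
  elt :> Type;
  le : relation elt;
  le_order : order elt le;
  join : elt -> elt -> elt;
  le_join_l : forall i j, le i (join i j);
  le_join_r : forall i j, le j (join i j);
  join_least : forall i j k, le i k -> le j k -> le (join i j) k
}.

Arguments le {s} _ _.
Arguments join {s} _ _.

Record ssl_hom (I P : sup_semilattice) : Type := SslHom {
  ssl_fun :> I -> P;
  ssl_fun_join : forall i j, ssl_fun (join i j) = join (ssl_fun i) (ssl_fun j)
}.

Lemma ssl_hom_ext (I P : sup_semilattice) (f g : ssl_hom I P) :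
  (forall i, f i = g i) -> f = g.
Proof.
destruct f as [f Hf], g as [g Hg]; simpl; intros e.
assert (f = g) by (apply functional_extensionality; exact e).
subst g; f_equal; apply proof_irrelevance.
Qed.

Lemma ssl_hom_le (I P : sup_semilattice) (xi : ssl_hom I P) (i j : I) :
  le i j -> le (xi i) (xi j).
Proof.
intros h.
assert (e : join i j = j).
{ apply (ord_antisym _ _ (le_order I)).
  - apply join_least; [exact h | apply (ord_refl _ _ (le_order I))].
  - apply le_join_r. }
rewrite <- e, ssl_fun_join; apply le_join_l.
Qed.

Definition ssl_id (I : sup_semilattice) : ssl_hom I I.
Proof. exists (fun i => i); reflexivity. Defined.

Definition ssl_comp (I P Q : sup_semilattice)
  (psi : ssl_hom P Q) (xi : ssl_hom I P) : ssl_hom I Q.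
Proof.
exists (fun i => psi (xi i)).
intros i j; rewrite (ssl_fun_join xi); apply ssl_fun_join.
Defined.

Definition Ssl : category.
Proof.
refine (@Category sup_semilattice ssl_hom ssl_id ssl_comp _ _ _);
  intros; apply ssl_hom_ext; reflexivity.
Defined.

(* The laws range over all proofs of the inequalities involved, so that
   [trans] does not depend on the proof of [le i j] it is given. *)
Record inductive_system (Sigma : signature) (I : sup_semilattice) : Type :=
  InductiveSystem {
    alg :> I -> Alg Sigma;
    trans : forall i j, le i j -> hom (alg i) (alg j);
    trans_id : forall i (h : le i i), trans h = idm (alg i);
    trans_comp : forall i j k (hij : le i j) (hjk : le j k) (hik : le i k),
      trans hjk ∘ trans hij = trans hik
  }.

Arguments trans {Sigma I} _ {i j} _.

Record system_hom (Sigma : signature) (I : sup_semilattice)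
  (A B : inductive_system Sigma I) : Type := SystemHom {
    fiber_hom :> forall i, hom (A i) (B i);
    fiber_hom_trans : forall i j (h : le i j),
      fiber_hom j ∘ trans A h = trans B h ∘ fiber_hom i
  }.

Definition reindex (Sigma : signature) (I P : sup_semilattice)
  (xi : ssl_hom I P) (B : inductive_system Sigma P) :
  inductive_system Sigma I.
Proof.
refine (@InductiveSystem Sigma I (fun i => B (xi i))
          (fun i j h => trans B (ssl_hom_le xi h)) _ _).
- intros; apply trans_id.
- intros; apply trans_comp.
Defined.

Record isys (Sigma : signature) : Type := Isys {
  index : sup_semilattice;
  system :> inductive_system Sigma index
}.

Record isys_hom (Sigma : signature) (X Y : isys Sigma) : Type := IsysHom {
  index_hom : ssl_hom (index X) (index Y);
  total_hom : system_hom X (reindex index_hom Y)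
}.

Definition isys_id (Sigma : signature) (X : isys Sigma) : isys_hom X X.
Proof.
exists (ssl_id (index X)).
refine (@SystemHom Sigma _ X (reindex (ssl_id (index X)) X)
          (fun i => idm (X i)) _).
intros i j h; simpl; apply algebra_hom_ext; intros a; simpl.
f_equal; f_equal; apply proof_irrelevance.
Defined.

Definition isys_comp (Sigma : signature) (X Y Z : isys Sigma)
  (G : isys_hom Y Z) (F : isys_hom X Y) : isys_hom X Z.
Proof.
exists (ssl_comp (index_hom G) (index_hom F)).
refine (@SystemHom Sigma _ X
          (reindex (ssl_comp (index_hom G) (index_hom F)) Z)
          (fun i => total_hom G (index_hom F i) ∘ total_hom F i) _).
intros i j h.
pose proof (fiber_hom_trans (total_hom F) h) as eF.
pose proof (fiber_hom_trans (total_hom G) (ssl_hom_le (index_hom F) h)) as eG.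
apply algebra_hom_ext; intros a.
apply (f_equal (fun f : algebra_hom _ _ => f a)) in eF.
apply (f_equal (fun f : algebra_hom _ _ => f (total_hom F i a))) in eG.
simpl in *; rewrite eF, eG.
do 2 f_equal; apply proof_irrelevance.
Defined.

Lemma isys_hom_ext (Sigma : signature) (X Y : isys Sigma)
  (xi : index X -> index Y)
  (Hxi Hxi' : forall i j, xi (join i j) = join (xi i) (xi j))
  (u u' : forall i, hom (X i) (Y (xi i))) Hu Hu' :
  (forall i, u i = u' i) ->
  @IsysHom Sigma X Y (SslHom Hxi)
    (@SystemHom Sigma _ X (reindex (SslHom Hxi) Y) u Hu) =
  @IsysHom Sigma X Y (SslHom Hxi')
    (@SystemHom Sigma _ X (reindex (SslHom Hxi') Y) u' Hu').
Proof.
intros e.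
assert (u = u') by (apply functional_extensionality_dep; exact e); subst u'.
assert (Hxi = Hxi') by apply proof_irrelevance; subst Hxi'.
do 2 f_equal; apply proof_irrelevance.
Qed.

(* The Grothendieck construction ∫^Ssl Isys_Sigma. *)
Definition IsysTotal (Sigma : signature) : category.
Proof.
refine (@Category (isys Sigma) (@isys_hom Sigma)
          (@isys_id Sigma) (@isys_comp Sigma) _ _ _).
- intros X Y [[xi Hxi] [u Hu]]; apply isys_hom_ext.
  intros i; apply comp_id_l.
- intros X Y [[xi Hxi] [u Hu]]; apply isys_hom_ext.
  intros i; apply comp_id_r.
- intros W X Y Z H G F; apply isys_hom_ext.
  intros i; apply comp_assoc.
Defined.

(* T_Sigma(∅) is the algebra of terms over no variables. *)
Definition L_obj (Sigma : signature) (I : sup_semilattice) : isys Sigma.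
Proof.
refine (@Isys Sigma I
          (@InductiveSystem Sigma I
             (fun _ => free_algebra Sigma Empty_set)
             (fun _ _ _ => idm (free_algebra Sigma Empty_set : Alg Sigma)) _ _)).
- reflexivity.
- intros; apply comp_id_l.
Defined.

Definition L_map (Sigma : signature) (I P : sup_semilattice)
  (xi : ssl_hom I P) : isys_hom (L_obj Sigma I) (L_obj Sigma P).
Proof.
exists xi.
refine (@SystemHom Sigma _ (L_obj Sigma I) (reindex xi (L_obj Sigma P))
          (fun _ => idm (free_algebra Sigma Empty_set : Alg Sigma)) _).
reflexivity.
Defined.

Definition L (Sigma : signature) : functor Ssl (IsysTotal Sigma).
Proof.
refine (@Functor Ssl (IsysTotal Sigma) (L_obj Sigma) (@L_map Sigma) _ _).
- intros I; apply isys_hom_ext; reflexivity.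
- intros I P Q psi xi; apply isys_hom_ext.
  intros i; symmetry; apply comp_id_l.
Defined.

Definition K_obj (Sigma : signature) (I : sup_semilattice) : isys Sigma.
Proof.
refine (@Isys Sigma I
          (@InductiveSystem Sigma I
             (fun i => singleton_algebra Sigma i)
             (fun i j _ => to_singleton (singleton_algebra Sigma i) j) _ _)).
- intros; apply to_singleton_unique.
- intros; apply to_singleton_unique.
Defined.

Definition K_map (Sigma : signature) (I P : sup_semilattice)
  (xi : ssl_hom I P) : isys_hom (K_obj Sigma I) (K_obj Sigma P).
Proof.
exists xi.
refine (@SystemHom Sigma _ (K_obj Sigma I) (reindex xi (K_obj Sigma P))
          (fun i => to_singleton (singleton_algebra Sigma i) (xi i)) _).
intros i j h; apply to_singleton_unique.
Defined.

Definition K (Sigma : signature) : functor Ssl (IsysTotal Sigma).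
Proof.
refine (@Functor Ssl (IsysTotal Sigma) (K_obj Sigma) (@K_map Sigma) _ _).
- intros I; apply isys_hom_ext; intros i; apply to_singleton_unique.
- intros I P Q psi xi; apply isys_hom_ext; intros i; apply to_singleton_unique.
Defined.

(* Main.v *)
(* Every algebra has exactly one homomorphism to a one-element algebra.  So the
   identity of [I] with the homomorphisms from [T_Sigma(∅)] to [K_{i}] is a
   morphism from [L(I)] to [K(I)], and since both sides of each compatibility and
   naturality equation are homomorphisms to one-element algebras, they agree. *)
Require Import Defs.

Definition gamma_component (Sigma : signature) (I : sup_semilattice) :
  isys_hom (L_obj Sigma I) (K_obj Sigma I).
Proof.
exists (ssl_id I).
refine (@SystemHom Sigma _ (L_obj Sigma I) (reindex (ssl_id I) (K_obj Sigma I))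
          (fun i => to_singleton (free_algebra Sigma Empty_set) i) _).
intros i j h; apply to_singleton_unique.
Defined.

Definition gamma (Sigma : signature) :
  natural_transformation (L Sigma) (K Sigma).
Proof.
refine (@NaturalTransformation _ _ (L Sigma) (K Sigma)
          (@gamma_component Sigma) _).
(* [isys_hom_ext] needs one common index map: composing [xi] with an identity on either side gives
   [xi] up to conversion, so only the fibre homomorphisms remain to be compared. *)
intros I P xi; apply isys_hom_ext; intros i; apply to_singleton_unique.
Defined.

Theorem proposition3p9 (Sigma : signature) :
  inhabited (natural_transformation (L Sigma) (K Sigma)).
Proof. exact (inhabits (gamma Sigma)). Qed.
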